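(* For every $n\in\mathbb{N}$, \[ \mathcal{M}^{(1/2)}(n)=\min_{1\le s\le t\le n}\mathcal{M}^{(1/2)}(n,s,t)=\Bigl\lfloor\frac{15n^2+72}{76}\Bigr\rfloor+\begin{cases}1,& n\equiv 18 \text{ or } n\equiv 20\pmod{38},\\ -1,& n\equiv 19\pmod{38},\\ 0,&\text{otherwise}.\end{cases} \]
   Context: For real $a>0$ and integers $1\le s\le t\le n$, $\mathcal{M}^{(a)}(n,s,t)$ is the number of ordered triples $T=(x,y,x+\lfloor ay\rfloor)\in\{1,\dots,n\}^3$ such that $T\in(\{1,\dots,s\}\cup\{t+1,\dots,n\})^3$ or $T\in\{s+1,\dots,t\}^3$ (monochromatic generalized Schur triples under the coloring $R^sB^{t-s}R^{n-t}$). For $a=1/2$ the triples are $(x,y,x+\lfloor y/2\rfloor)$. *)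

(* Defs.v *)
From mathcomp Require Import all_boot all_order all_algebra.
Set Implicit Arguments. Unset Strict Implicit. Unset Printing Implicit Defensive.

(* Coloring R^s B^(t-s) R^(n-t) of {1,...,n}: i is red iff i <= s or t < i. *)
Definition red (s t i : nat) : bool := (i <= s) || (t < i).

Definition mono (s t x y z : nat) : bool :=
  (red s t x && red s t y && red s t z) ||
  (~~ red s t x && ~~ red s t y && ~~ red s t z).

Definition Mhalf (n s t : nat) : nat :=
  \sum_(1 <= x < n.+1) \sum_(1 <= y < n.+1)
     ((x + y./2 <= n) && mono s t x y (x + y./2)).

Definition Mformula (n : nat) : int :=
  (Posz (divn (15 * expn n 2 + 72) 76) +
   (if (modn n 38 == 18) || (modn n 38 == 20) then 1
    else if modn n 38 == 19 then -1 else 0))%R.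

(* Main.v *)
From Stdlib Require Import ZArith Lia.
Require Import Defs.
From mathcomp Require Import all_boot all_order all_algebra zify ssrZ.
Set Implicit Arguments. Unset Strict Implicit. Unset Printing Implicit Defensive.

(* Counting column by column (fixed y, h = floor(y/2)), every column is a sum of
   truncated linear functions of h, so the number of monochromatic triples is
   exactly a quadratic form in (n, s, t) plus signed quarter-squares
   floor(x_+^2/4) of linear forms x.  Near the continuous minimiser
   (s, t) = (4n/19, 12n/19) this reads, with u = 19s - 4n and j = t - 3s,
     76 M >= 15n^2 + 5u^2 + 76uj + 304j^2 + 19((s mod 2) - (n mod 2)),
   with equality if 2s <= t.  The form in (u, j) is positive definite and u, j
   are constrained modulo 19 and 2 by n, which yields the rounding corrections.
   Away from the minimiser the quadratic pieces exceed (15/76)n^2 by a fixed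
   proportion of n^2, enough once n >= 42; smaller n are checked by computation
   on the closed form.  The nearest integers to 4n/19 and 12n/19 attain the
   bound, except for n = 1, 2, 4. *)

(* The key Z is bound to int_scope by ssrint. *)
Delimit Scope Z_scope with ZZ.
Local Arguments Z.mul : simpl never.
Local Arguments Z.add : simpl never.

(** * Truncated quarter-squares *)

Definition quarter_sq (x : Z) : Z := if (0 <? x)%ZZ then (x * x / 4)%ZZ else 0%ZZ.

Lemma quarter_sq_le0 (x : Z) : (x <= 0)%ZZ -> quarter_sq x = 0%ZZ.
Proof. by rewrite /quarter_sq; case: Z.ltb_spec => //; lia. Qed.

Lemma quarter_sq_ge0 (x : Z) :
  (0 <= x)%ZZ -> (4 * quarter_sq x = x * x - x mod 2)%ZZ.
Proof.
rewrite /quarter_sq; case: Z.ltb_spec => [x0 _|x0 x0']; last first.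
  by have -> : x = 0%ZZ by lia.
have [f [->|->]] : exists f, (x = 2 * f \/ x = 2 * f + 1)%ZZ.
- by exists (x / 2)%ZZ; Z.to_euclidean_division_equations; lia.
- have -> : (2 * f * (2 * f) = (f * f) * 4)%ZZ by ring.
  by rewrite Z.div_mul //; Z.to_euclidean_division_equations; nia.
- have -> : ((2 * f + 1) * (2 * f + 1) = (f * f + f) * 4 + 1)%ZZ by ring.
  by rewrite Z.div_add_l //; Z.to_euclidean_division_equations; nia.
Qed.

Lemma quarter_sq_nonneg (x : Z) : (0 <= quarter_sq x)%ZZ.
Proof.
have [/quarter_sq_le0 ->|/quarter_sq_ge0] := Z.le_ge_cases x 0; first by [].
have ? : (x mod 2 <= x * x)%ZZ; last by lia.
have ? := Z.mod_pos_bound x 2 erefl.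
have [->|?] : (x = 0 \/ 1 <= x * x)%ZZ by nia.
  by [].
lia.
Qed.

(** This bound has no sign condition, so quarter-squares entering with a minus sign can be estimated
    before the sign of their argument is known. *)
Lemma quarter_sq_le (x : Z) : (4 * quarter_sq x <= x * x)%ZZ.
Proof.
have [/quarter_sq_le0 ->|/quarter_sq_ge0] := Z.le_ge_cases x 0; first by nia.
by have ? := Z.mod_pos_bound x 2 erefl; lia.
Qed.

Lemma quarter_sq_ge (x : Z) : (0 <= x -> x * x - 1 <= 4 * quarter_sq x)%ZZ.
Proof.
by move=> /quarter_sq_ge0; have ? := Z.mod_pos_bound x 2 erefl; lia.
Qed.

Lemma quarter_sqS (x : Z) :
  (0 <= x)%ZZ -> quarter_sq (x + 1) = (quarter_sq x + (x + 1) / 2)%ZZ.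
Proof.
move=> x0; have q1 := quarter_sq_ge0 x0.
have /quarter_sq_ge0 q2 : (0 <= x + 1)%ZZ by lia.
Z.to_euclidean_division_equations; lia.
Qed.

(** * Sums of truncated linear functions of floor(y/2) *)

(** With x = m - 2d, raising m by one adds floor((x+1)/2) on both sides; truncated subtraction
    matches the cut-off of [quarter_sq] at x <= 0. *)
Lemma sum_half_excess (d m : nat) :
  Z.of_nat (\sum_(1 <= y < m.+1) (y./2 - d)) = quarter_sq (Z.of_nat m - 2 * Z.of_nat d).
Proof.
elim: m => [|m IH].
  by rewrite big_geq // quarter_sq_le0 //; lia.
rewrite big_nat_recr // Nat2Z.inj_add IH {IH}.
case: (leqP d.*2 m) => dm; last by rewrite !quarter_sq_le0; lia.
have -> : (Z.of_nat m.+1 - 2 * Z.of_nat d = (Z.of_nat m - 2 * Z.of_nat d) + 1)%ZZ by lia.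
by rewrite quarter_sqS; Z.to_euclidean_division_equations; lia.
Qed.

(** Termwise, (a - h) + h = (h - a) + a in truncated subtraction, which reduces deficits to
    excesses. *)
Lemma sum_half_deficit (a m : nat) :
  Z.of_nat (\sum_(1 <= y < m.+1) (a - y./2)) =
  (Z.of_nat a * Z.of_nat m - quarter_sq (Z.of_nat m)
   + quarter_sq (Z.of_nat m - 2 * Z.of_nat a))%ZZ.
Proof.
have := sum_half_excess 0 m; have := sum_half_excess a m.
have : \sum_(1 <= y < m.+1) (a - y./2) + \sum_(1 <= y < m.+1) (y./2 - 0)
   = \sum_(1 <= y < m.+1) (y./2 - a) + a * m.
  rewrite -!big_split /= -[m in (a * m)]subn0 -(subSS 0 m) mulnC -sum_nat_const_nat -big_split /=.
  by apply: eq_bigr => y _; lia.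
rewrite Z.sub_0_r; nia.
Qed.

(** * Counting the triples with a fixed y *)

Lemma sum_indicator (a b n : nat) :
  b <= n -> \sum_(1 <= x < n.+1) ((a < x) && (x <= b)) = b - a.
Proof.
elim: n b => [|n IH] b bn; first by rewrite big_geq //; lia.
rewrite big_nat_recr //=.
case: (leqP b n) => bn'; first by rewrite IH //; lia.
have -> : b = n.+1 by lia.
rewrite (eq_big_nat _ _ (F2 := fun x => (a < x) && (x <= n) : nat)) ?IH //; first by lia.
by move=> x xn; congr nat_of_bool; lia.
Qed.

(** For red y and h = floor(y/2), the summands count x with x and x + h both in the left red block,
    both in the right one, and x in the left with x + h in the right. *)
Definition red_column (n s t h : nat) : nat :=
  (s - h) + (n - t - h) + minn (minn s (n - t)) (h - (t - s)).

Lemma sum_mono_x (n s t y : nat) : s <= t -> t <= n -> 0 < y -> y <= n ->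
  \sum_(1 <= x < n.+1) ((x + y./2 <= n) && mono s t x y (x + y./2)) =
  if red s t y then red_column n s t y./2 else t - s - y./2.
Proof.
move=> st tn y0 yn; rewrite /mono.
(* The crossing pairs satisfy t - h < x <= min(s, n - h). Rewriting their number as in [red_column]
   relies on h <= n/2. *)
have -> : red_column n s t y./2 =
   (s - y./2 - 0) + (n - y./2 - t) + (minn s (n - y./2) - (t - y./2)).
  by rewrite /red_column; congr (_ + _ + _); lia.
case yr : (red s t y); last first.
  have -> : t - s - y./2 = t - y./2 - s by lia.
  rewrite -(sum_indicator _ (n := n)); last by lia.
  by apply: eq_big_nat => x xn; congr nat_of_bool; rewrite /red; lia.
rewrite -(@sum_indicator 0 (s - y./2) n); last by lia.
rewrite -(@sum_indicator t (n - y./2) n); last by lia.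
rewrite -(@sum_indicator (t - y./2) (minn s (n - y./2)) n); last by lia.
rewrite -!big_split /=; apply: eq_big_nat => x xn.
rewrite /red; move: (y./2) => h.
case: (leqP x s); case: (ltnP t x); case: (leqP (x + h) s); case: (ltnP t (x + h));
  case: (leqP (x + h) n) => /=; lia.
Qed.

Lemma sum_minn_half_excess (c d m : nat) :
  Z.of_nat (\sum_(1 <= y < m.+1) minn c (y./2 - d)) =
  (quarter_sq (Z.of_nat m - 2 * Z.of_nat d)
   - quarter_sq (Z.of_nat m - 2 * Z.of_nat (d + c)))%ZZ.
Proof.
rewrite -!sum_half_excess.
have : \sum_(1 <= y < m.+1) minn c (y./2 - d) + \sum_(1 <= y < m.+1) (y./2 - (d + c))
   = \sum_(1 <= y < m.+1) (y./2 - d).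
  by rewrite -big_split /=; apply: eq_bigr => y _; lia.
lia.
Qed.

(** * The closed form of the count *)

(** One formula covers both values of min(s, n - t): the term in n - 2t vanishes when s + t > n, and
    those in t + 2s - 2n, 3s - 2n and 2s - n vanish when s + t <= n. *)
Definition schur_closed (n s t : Z) : Z :=
  (s * s + (t - s) * (t - s) + (n - t) * (n - t) + 2 * (s * (n - t))
   - quarter_sq s + quarter_sq t - 2 * quarter_sq n
   + quarter_sq (s + 2 * t - 2 * n) + quarter_sq (t + 2 * s - 2 * n)
   + quarter_sq (n - 2 * t + 2 * s) - quarter_sq (t - 2 * s)
   - quarter_sq (3 * t - 2 * n) - quarter_sq (3 * s - 2 * n)
   + quarter_sq (n - 2 * s) - quarter_sq (2 * s - n)
   + quarter_sq (2 * t - n) - quarter_sq (n - 2 * t))%ZZ.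

Lemma sum_red_column (n s t m : nat) :
  Z.of_nat (\sum_(1 <= y < m.+1) red_column n s t y./2) =
  (Z.of_nat (s + (n - t)) * Z.of_nat m - 2 * quarter_sq (Z.of_nat m)
   + quarter_sq (Z.of_nat m - 2 * Z.of_nat s)
   + quarter_sq (Z.of_nat m - 2 * Z.of_nat (n - t))
   + quarter_sq (Z.of_nat m - 2 * Z.of_nat (t - s))
   - quarter_sq (Z.of_nat m - 2 * Z.of_nat (t - s + minn s (n - t))))%ZZ.
Proof.
have -> : \sum_(1 <= y < m.+1) red_column n s t y./2 =
    \sum_(1 <= y < m.+1) (s - y./2) + \sum_(1 <= y < m.+1) (n - t - y./2)
    + \sum_(1 <= y < m.+1) minn (minn s (n - t)) (y./2 - (t - s)).
  by rewrite -!big_split.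
rewrite !Nat2Z.inj_add !sum_half_deficit sum_minn_half_excess Nat2Z.inj_add; ring.
Qed.

(** The sums over the three colour blocks of y are differences of prefix sums; negative terms are
    moved across to stay within the naturals. *)
Lemma Mhalf_split (n s t : nat) : s <= t -> t <= n ->
  Mhalf n s t + \sum_(1 <= y < s.+1) (t - s - y./2)
   + \sum_(1 <= y < t.+1) red_column n s t y./2 =
  \sum_(1 <= y < s.+1) red_column n s t y./2 + \sum_(1 <= y < t.+1) (t - s - y./2)
   + \sum_(1 <= y < n.+1) red_column n s t y./2.
Proof.
move=> st tn; rewrite /Mhalf exchange_big /=.
rewrite (eq_big_nat _ _ (F2 := fun y => if red s t y
  then red_column n s t y./2 else t - s - y./2)); last first.
  by move=> y yn; apply: sum_mono_x; lia.
have split3 F m p : m <= p ->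
    \sum_(1 <= y < p.+1) F y = \sum_(1 <= y < m.+1) F y + \sum_(m.+1 <= y < p.+1) F y :> nat.
  by move=> mp; rewrite -big_cat_nat.
rewrite (split3 _ t n tn) (split3 _ s t st).
rewrite [in RHS](split3 (fun y => red_column n s t y./2) t n tn).
rewrite [in RHS](split3 (fun y => t - s - y./2) s t st).
rewrite (eq_big_nat _ _ (m := 1) (n := s.+1) (F2 := fun y => red_column n s t y./2)); last first.
  by move=> y ys; have -> : red s t y by rewrite /red; lia.
rewrite (eq_big_nat _ _ (m := s.+1) (n := t.+1) (F2 := fun y => t - s - y./2)); last first.
  by move=> y ys; have -> : red s t y = false by rewrite /red; lia.
rewrite (eq_big_nat _ _ (m := t.+1) (n := n.+1) (F2 := fun y => red_column n s t y./2)); last first.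
  by move=> y ys; have -> : red s t y by rewrite /red; lia.
lia.
Qed.

Lemma Mhalf_closed (n s t : nat) : s <= t -> t <= n ->
  Z.of_nat (Mhalf n s t) = schur_closed (Z.of_nat n) (Z.of_nat s) (Z.of_nat t).
Proof.
move=> st tn; have /(congr1 Z.of_nat) := Mhalf_split st tn.
rewrite !Nat2Z.inj_add !sum_red_column !sum_half_deficit /schur_closed.
rewrite (Nat2Z.inj_sub n t) ?(Nat2Z.inj_sub t s); try lia.
set N := Z.of_nat n; set S := Z.of_nat s; set T := Z.of_nat t.
have -> : quarter_sq (S - 2 * S) = 0%ZZ by apply: quarter_sq_le0; lia.
have -> : (S - 2 * (N - T) = S + 2 * T - 2 * N)%ZZ by lia.
have -> : (N - 2 * (T - S) = N - 2 * T + 2 * S)%ZZ by lia.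
have -> : (N - 2 * (N - T) = 2 * T - N)%ZZ by lia.
have -> : (T - 2 * (N - T) = 3 * T - 2 * N)%ZZ by lia.
have -> : Z.of_nat (s + (n - t)) = (S + (N - T))%ZZ by lia.
have [snt|snt] := leqP s (n - t).
  have -> : Z.of_nat (t - s + s) = T by lia.
  rewrite (@quarter_sq_le0 (T - 2 * T)) ?(@quarter_sq_le0 (S - 2 * T)); try lia.
  rewrite (@quarter_sq_le0 (T + 2 * S - 2 * N)); last by lia.
  rewrite (@quarter_sq_le0 (3 * S - 2 * N)) ?(@quarter_sq_le0 (2 * S - N)); lia.
rewrite (@quarter_sq_le0 (N - 2 * T)); last by lia.
have -> : Z.of_nat (t - s + (n - t)) = (N - S)%ZZ by lia.
have -> : (T - 2 * (N - S) = T + 2 * S - 2 * N)%ZZ by lia.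
have -> : (S - 2 * (N - S) = 3 * S - 2 * N)%ZZ by lia.
have -> : (N - 2 * (N - S) = 2 * S - N)%ZZ by lia.
lia.
Qed.

(** * The region around the minimiser *)

(** The region fixes the sign of every quarter-square argument except t - 2s. The parities of t
    cancel, leaving those of s and n. If t < 2s, the term subtracted for t - 2s is 0, at most its
    polynomial value, so only an inequality remains. *)
Lemma central_identity (n s t : Z) (u := (19 * s - 4 * n)%ZZ) (j := (t - 3 * s)%ZZ)
  (q := (15 * (n * n) + 5 * (u * u) + 76 * (u * j) + 304 * (j * j)
         + 19 * (s mod 2 - n mod 2))%ZZ) :
  (0 <= s -> s <= t -> n <= 2 * t -> 3 * t <= 2 * n -> 2 * (t - s) <= n -> 2 * s <= n ->
   (q <= 76 * schur_closed n s t /\ (2 * s <= t -> 76 * schur_closed n s t = q)))%ZZ.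
Proof.
move=> s0 st h1 h2 h3 h4.
have t0 : (0 <= t)%ZZ by lia.
have n0 : (0 <= n)%ZZ by lia.
have H1 := quarter_sq_ge0 s0; have H2 := quarter_sq_ge0 t0.
have H3 := quarter_sq_ge0 n0.
have /quarter_sq_ge0 H4 : (0 <= n - 2 * t + 2 * s)%ZZ by lia.
have /quarter_sq_ge0 H5 : (0 <= n - 2 * s)%ZZ by lia.
have /quarter_sq_ge0 H6 : (0 <= 2 * t - n)%ZZ by lia.
have H7 : (4 * quarter_sq (t - 2 * s) <= (t - 2 * s) * (t - 2 * s) - t mod 2 /\
  (2 * s <= t -> 4 * quarter_sq (t - 2 * s) = (t - 2 * s) * (t - 2 * s) - t mod 2))%ZZ.
  have [/quarter_sq_ge0 H|H] := Z.le_ge_cases 0 (t - 2 * s)%ZZ.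
    rewrite H; Z.to_euclidean_division_equations; lia.
  rewrite quarter_sq_le0 //.
  have [e|e] : (t - 2 * s = 0 \/ t - 2 * s <= -1)%ZZ by lia.
    rewrite e; Z.to_euclidean_division_equations; lia.
  split; last by lia.
  have ? : (1 <= (t - 2 * s) * (t - 2 * s))%ZZ by nia.
  have ? := Z.mod_pos_bound t 2; lia.
have E1 : ((n - 2 * t + 2 * s) mod 2 = n mod 2)%ZZ.
  have -> : (n - 2 * t + 2 * s = n + (s - t) * 2)%ZZ by ring.
  exact: Z_mod_plus_full.
have E2 : ((n - 2 * s) mod 2 = n mod 2)%ZZ.
  have -> : (n - 2 * s = n + (- s) * 2)%ZZ by ring.
  exact: Z_mod_plus_full.
have E3 : ((2 * t - n) mod 2 = n mod 2)%ZZ.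
  have -> : (2 * t - n = n + (t - n) * 2)%ZZ by ring.
  exact: Z_mod_plus_full.
rewrite E1 in H4; rewrite E2 in H5; rewrite E3 in H6.
rewrite /schur_closed (@quarter_sq_le0 (s + 2 * t - 2 * n)); last by lia.
rewrite (@quarter_sq_le0 (t + 2 * s - 2 * n)); last by lia.
rewrite (@quarter_sq_le0 (3 * t - 2 * n)) ?(@quarter_sq_le0 (3 * s - 2 * n)); try lia.
rewrite (@quarter_sq_le0 (2 * s - n)) ?(@quarter_sq_le0 (n - 2 * t)); lia.
Qed.

Definition optimum (n : Z) : Z :=
  ((15 * (n * n) + 72) / 76 + (if (n mod 38 =? 18) || (n mod 38 =? 20) then 1
    else if n mod 38 =? 19 then -1 else 0))%ZZ.

(** Completing the square in either variable: 5f - 76j^2 = (5u + 38j)^2 and 304f - 76u^2 = (38u +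
    304j)^2. *)
Lemma central_form_lower (u j : Z) (f := (5 * (u * u) + 76 * (u * j) + 304 * (j * j))%ZZ) :
  (0 <= f /\ 76 * (j * j) <= 5 * f /\ 19 * (u * u) <= 76 * f)%ZZ.
Proof.
have ? := Z.square_nonneg (5 * u + 38 * j); have ? := Z.square_nonneg (38 * u + 304 * j).
by have ? := Z.square_nonneg j; rewrite /f; lia.
Qed.

Lemma central_lower (n s t : Z) :
  (0 <= s -> s <= t -> n <= 2 * t -> 3 * t <= 2 * n -> 2 * (t - s) <= n -> 2 * s <= n ->
   optimum n <= schur_closed n s t)%ZZ.
Proof.
move=> s0 st h1 h2 h3 h4.
have [H _] := central_identity s0 st h1 h2 h3 h4.
have [f0 [fj fu]] := central_form_lower (19 * s - 4 * n) (t - 3 * s).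
move: (schur_closed n s t) H => M H.
have : exists u, (u = 19 * s - 4 * n)%ZZ by eexists.
have : exists j, (j = t - 3 * s)%ZZ by eexists.
(* From here j is an arbitrary integer; [eu] is kept because it ties u to n modulo 19 and to s
   modulo 2. *)
move=> [j ej] [u eu]; rewrite -eu -ej in H f0 fj fu; clear ej h1 h2 h3 h4 st.
apply: Znot_gt_le; rewrite /optimum.
have euclid (x d : Z) : (0 < d)%ZZ -> exists k r, (x = d * k + r /\ 0 <= r < d /\ x mod d = r)%ZZ.
  by move=> d0; exists (x / d)%ZZ, (x mod d)%ZZ; Z.to_euclidean_division_equations; lia.
have [k [r [ek [rr ->]]]] := euclid n 38%ZZ erefl.
have [h [a [ea [ar en]]]] := euclid n 2%ZZ erefl.
have [l [b [eb [br es]]]] := euclid s 2%ZZ erefl.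
rewrite en es in H; have := @Z.mul_div_le (15 * (n * n) + 72) 76 erefl.
move: (_ / 76)%ZZ => F FE.
case: (Z.eqb_spec r 18) => [r18|r18] /=; last case: (Z.eqb_spec r 20) => [r20|r20] /=;
  last case: (Z.eqb_spec r 19) => [r19|r19] /= G.
(* Here n is even, so a value below the optimum forces f <= 72. *)
- move=> G.
  have j2 : (-2 <= j <= 2)%ZZ by nia.
  have uu : (u * u <= 288)%ZZ by lia.
  have u2 : (-17 <= u <= 17)%ZZ by clear - uu; nia.
  (* Since u = -4n = 4 mod 19, these are the candidates. For u = 4, f = 80 + 304j(j + 1) >= 80. For
     u = -15, s is odd, and the minimum 61 of f, at j = 2, plus 19 is again 80. *)
  have [e|e] : (u = 4 \/ u = -15)%ZZ by lia.
    nia.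
  nia.
(* Mirror image of the previous case under (u, j) -> (-u, -j). *)
- move=> G.
  have j2 : (-2 <= j <= 2)%ZZ by nia.
  have uu : (u * u <= 288)%ZZ by lia.
  have u2 : (-17 <= u <= 17)%ZZ by clear - uu; nia.
  have [e|e] : (u = -4 \/ u = 15)%ZZ by lia.
    nia.
  nia.
(* The parity term is at least -19, while a smaller count would need -80. *)
- lia.
(* A smaller count needs n odd, s even and f <= 15. Then j = 0 and |u| <= 1; u is even, so u = 0 and
   19 divides the odd n, the excluded residue. *)
- have j0 : (j = 0)%ZZ by nia.
  have u1 : (-7 <= u <= 7)%ZZ by nia.
  subst j.
  have u2 : (-1 <= u <= 1)%ZZ by nia.
  lia.
Qed.

(** * The regions away from the minimiser *)

Lemma optimum_le (n : Z) : (76 * optimum n <= 15 * (n * n) + 148)%ZZ.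
Proof.
rewrite /optimum; have := @Z.mul_div_le (15 * (n * n) + 72) 76 erefl.
by case: ifP => _; last case: ifP => _; lia.
Qed.

(* The products and squares listed in each region are the certificate that the
   quadratic piece valid there is at least (15.15/19) n^2. *)
Lemma outer_lower (n s t : Z) : (42 <= n -> 0 <= s -> s <= t -> t <= n ->
  2 * t <= n \/ n <= 2 * s \/ n <= 2 * (t - s) \/ 2 * n <= 3 * t ->
  optimum n <= schur_closed n s t)%ZZ.
Proof.
move=> n42 s0 st tn outer.
(* The margin 0.15 n^2 >= 264 in 76M covers the 148 of [optimum_le] and a rounding loss of 19 for
   each of at most five quarter-squares bounded below. *)
have ? : (1764 <= n * n)%ZZ by nia.
have ? := @optimum_le n.
have ? := @quarter_sq_le s; have ? := @quarter_sq_le n.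
have ? : (t * t - 1 <= 4 * quarter_sq t)%ZZ by apply: quarter_sq_ge; lia.
have ? := @quarter_sq_nonneg (s + 2 * t - 2 * n).
have ? := @quarter_sq_nonneg (t + 2 * s - 2 * n).
have ? := @quarter_sq_nonneg (n - 2 * t + 2 * s).
have ? := @quarter_sq_nonneg (n - 2 * s).
have ? := @quarter_sq_nonneg (2 * t - n).
have ? := @quarter_sq_le (t - 2 * s).
have ? := @quarter_sq_le (3 * t - 2 * n).
have ? := @quarter_sq_le (3 * s - 2 * n).
have ? := @quarter_sq_le (2 * s - n).
have ? := @quarter_sq_le (n - 2 * t).
rewrite /schur_closed.
have [t_half|t_half] := Z.le_gt_cases (2 * t) n.
  have ? := @quarter_sq_ge (n - 2 * t + 2 * s) ltac:(lia).
  have ? := @quarter_sq_ge (n - 2 * s) ltac:(lia).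
  rewrite (@quarter_sq_le0 (3 * t - 2 * n)) ?(@quarter_sq_le0 (3 * s - 2 * n)); try lia.
  rewrite (@quarter_sq_le0 (2 * s - n)); last lia.
  have ? : (0 <= (3 * s - t) * (3 * s - t) /\ 0 <= s * s
    /\ 0 <= (n - 2 * t) * (n - 2 * t) /\ 0 <= (t - s) * (n - 2 * t)
    /\ 0 <= s * (n - 2 * t) /\ 0 <= s * (n - t))%ZZ.
    by do ?split; first [exact: Z.square_nonneg | apply: Z.mul_nonneg_nonneg; lia].
  lia.
have ? := @quarter_sq_ge (2 * t - n) ltac:(lia).
rewrite (@quarter_sq_le0 (n - 2 * t)); last lia.
have [s_half|s_half] := Z.le_gt_cases n (2 * s).
  rewrite (@quarter_sq_le0 (t - 2 * s)); last lia.
  have ? := @quarter_sq_ge (n - 2 * t + 2 * s) ltac:(lia).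
  have [t_third|t_third] := Z.le_gt_cases (3 * t) (2 * n).
    rewrite (@quarter_sq_le0 (3 * t - 2 * n)) ?(@quarter_sq_le0 (3 * s - 2 * n)); try lia.
    have ? : (0 <= s * s /\ 0 <= (2 * s - n) * (2 * n - 3 * t)
      /\ 0 <= (2 * n - 3 * t) * (2 * n - 3 * t) /\ 0 <= s * (2 * n - 3 * t)
      /\ 0 <= (t - s) * (2 * s - n) /\ 0 <= s * (2 * s - n))%ZZ.
      by do ?split; first [exact: Z.square_nonneg | apply: Z.mul_nonneg_nonneg; lia].
    lia.
  have [s_third|s_third] := Z.le_gt_cases (3 * s) (2 * n).
    rewrite (@quarter_sq_le0 (3 * s - 2 * n)); last lia.
    have [st2|st2] := Z.le_gt_cases (2 * n) (s + 2 * t).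
      have ? := @quarter_sq_ge (s + 2 * t - 2 * n) ltac:(lia).
      have ? : (0 <= (n - t) * (2 * s - n) /\ 0 <= (2 * s - n) * (2 * s - n)
        /\ 0 <= (s - 3 * t + 2 * n) * (s - 3 * t + 2 * n) /\ 0 <= s * (2 * s - n)
        /\ 0 <= s * (n - t) /\ 0 <= (n - t) * (n - t))%ZZ.
        by do ?split; first [exact: Z.square_nonneg | apply: Z.mul_nonneg_nonneg; lia].
      lia.
    have ? : (0 <= s * s /\ 0 <= (3 * t - 2 * n) * (2 * n - 3 * s)
      /\ 0 <= (2 * s - n) * (2 * n - 3 * s) /\ 0 <= s * (2 * s - n)
      /\ 0 <= s * (2 * n - s - 2 * t) /\ 0 <= (3 * t - 2 * n) * (3 * t - 2 * n))%ZZ.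
      by do ?split; first [exact: Z.square_nonneg | apply: Z.mul_nonneg_nonneg; lia].
    lia.
  have ? := @quarter_sq_ge (s + 2 * t - 2 * n) ltac:(lia).
  have ? := @quarter_sq_ge (t + 2 * s - 2 * n) ltac:(lia).
  have ? : (0 <= (3 * s - 2 * n) * (3 * s - 2 * n) /\ 0 <= (n - t) * (3 * s - 2 * n)
    /\ 0 <= (3 * t - 2 * n) * (3 * t - 2 * n) /\ 0 <= s * (n - t)
    /\ 0 <= (3 * t - 2 * n) * (3 * s - 2 * n) /\ 0 <= (n - t) * (n - t))%ZZ.
    by do ?split; first [exact: Z.square_nonneg | apply: Z.mul_nonneg_nonneg; lia].
  lia.
have ? := @quarter_sq_ge (n - 2 * s) ltac:(lia).
rewrite (@quarter_sq_le0 (2 * s - n)) ?(@quarter_sq_le0 (3 * s - 2 * n)); try lia.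
have [blue_half|blue_half] := Z.le_gt_cases n (2 * (t - s)).
  have [t_third|t_third] := Z.le_gt_cases (3 * t) (2 * n).
    rewrite (@quarter_sq_le0 (3 * t - 2 * n)); last lia.
    have ? : (0 <= (2 * n - 3 * t) * (2 * (t - s) - n) /\ 0 <= (t - s) * (t - s)
      /\ 0 <= (2 * n - 3 * t) * (2 * n - 3 * t) /\ 0 <= (t - s) * (2 * (t - s) - n)
      /\ 0 <= (2 * (t - s) - n) * (2 * (t - s) - n) /\ 0 <= s * (t - s))%ZZ.
      by do ?split; first [exact: Z.square_nonneg | apply: Z.mul_nonneg_nonneg; lia].
    lia.
  have [st2|st2] := Z.le_gt_cases (2 * n) (s + 2 * t).
    have ? := @quarter_sq_ge (s + 2 * t - 2 * n) ltac:(lia).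
    have ? : (0 <= (t - s) * (n - t) /\ 0 <= (t - s) * (2 * (t - s) - n)
      /\ 0 <= (s + 2 * t - 2 * n) * (s + 2 * t - 2 * n)
      /\ 0 <= (n - t) * (2 * (t - s) - n)
      /\ 0 <= (2 * (t - s) - n) * (2 * (t - s) - n) /\ 0 <= s * (s + 2 * t - 2 * n))%ZZ.
      by do ?split; first [exact: Z.square_nonneg | apply: Z.mul_nonneg_nonneg; lia].
    lia.
  have ? : (0 <= (2 * (t - s) - n) * (2 * n - s - 2 * t)
    /\ 0 <= (2 * (t - s) - n) * (2 * (t - s) - n) /\ 0 <= (t - s) * (2 * (t - s) - n)
    /\ 0 <= (3 * t - 2 * n) * (2 * n - s - 2 * t) /\ 0 <= (t - s) * (t - s))%ZZ.
    by do ?split; first [exact: Z.square_nonneg | apply: Z.mul_nonneg_nonneg; lia].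
  lia.
have ? := @quarter_sq_ge (n - 2 * t + 2 * s) ltac:(lia).
(* The other three alternatives of [outer] have been ruled out. *)
have t_third : (2 * n <= 3 * t)%ZZ by lia.
have [st2|st2] := Z.le_gt_cases (2 * n) (s + 2 * t).
  have ? := @quarter_sq_ge (s + 2 * t - 2 * n) ltac:(lia).
  have ? : (0 <= (s + 2 * t - 2 * n) * (n - 2 * (t - s)) /\ 0 <= (n - 2 * s) * (n - 2 * s)
    /\ 0 <= s * (n - 2 * (t - s)) /\ 0 <= (n - 2 * (t - s)) * (n - 2 * (t - s))
    /\ 0 <= (7 * s - 7 * t + 3 * n) * (7 * s - 7 * t + 3 * n)
    /\ 0 <= (s + 2 * t - 2 * n) * (s + 2 * t - 2 * n))%ZZ.
    by do ?split; first [exact: Z.square_nonneg | apply: Z.mul_nonneg_nonneg; lia].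
  lia.
have ? : (0 <= s * s /\ 0 <= (t - s) * (3 * t - 2 * n) /\ 0 <= s * (3 * t - 2 * n)
  /\ 0 <= (11 * s - 10 * t + 4 * n) * (11 * s - 10 * t + 4 * n)
  /\ 0 <= (4 * s - n) * (4 * s - n) /\ 0 <= (3 * t - 2 * n) * (2 * n - s - 2 * t))%ZZ.
  by do ?split; first [exact: Z.square_nonneg | apply: Z.mul_nonneg_nonneg; lia].
lia.
Qed.

(** * Attainment of the bound *)

(** 4n/19 = 8n/38, and adding 19 rounds to nearest; no tie occurs, as 8n is even and 19 odd. *)
Definition nearest_s (n : Z) : Z := ((8 * n + 19) / 38)%ZZ.
Definition nearest_t (n : Z) : Z := ((24 * n + 19) / 38)%ZZ.

Definition central_excess (n : Z) : Z :=
  let s := nearest_s n in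
  let u := (19 * s - 4 * n)%ZZ in let j := (nearest_t n - 3 * s)%ZZ in
  (5 * (u * u) + 76 * (u * j) + 304 * (j * j) + 19 * (s mod 2 - n mod 2))%ZZ.

(** Replacing n by n + 38 shifts s by 8 and t by 24, fixing u, j and both parities; 15n^2 and 76
    times the optimum grow equally. So 38 residues are checked by computation. *)
Lemma nearest_optimum (n : Z) :
  (15 * (n * n) + central_excess n = 76 * optimum n)%ZZ.
Proof.
pose k := (n / 38)%ZZ; pose r := (n mod 38)%ZZ.
have nE : (n = r + k * 38)%ZZ by have := Z.div_mod n 38; rewrite -/k -/r; lia.
have r38 : (0 <= r < 38)%ZZ by apply: Z.mod_pos_bound.
have sE : nearest_s n = (nearest_s r + 8 * k)%ZZ.
  by rewrite /nearest_s -Z.div_add // nE; congr (_ / _)%ZZ; ring.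
have tE : nearest_t n = (nearest_t r + 24 * k)%ZZ.
  by rewrite /nearest_t -Z.div_add // nE; congr (_ / _)%ZZ; ring.
have FE : optimum n = (optimum r + (285 * (k * k) + 15 * (k * r)))%ZZ.
  rewrite /optimum nE Z_mod_plus_full.
  have -> : (15 * ((r + k * 38) * (r + k * 38)) + 72 =
    15 * (r * r) + 72 + (285 * (k * k) + 15 * (k * r)) * 76)%ZZ by ring.
  by rewrite Z.div_add //; ring.
have gE : central_excess n = central_excess r.
  rewrite /central_excess sE tE.
  have -> : (19 * (nearest_s r + 8 * k) - 4 * n = 19 * nearest_s r - 4 * r)%ZZ by lia.
  have -> : (nearest_t r + 24 * k - 3 * (nearest_s r + 8 * k) =
    nearest_t r - 3 * nearest_s r)%ZZ by ring.
  have -> : (nearest_s r + 8 * k = nearest_s r + 4 * k * 2)%ZZ by ring.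
  have -> : (n = r + 19 * k * 2)%ZZ by lia.
  by rewrite !Z_mod_plus_full.
have rE : (15 * (r * r) + central_excess r = 76 * optimum r)%ZZ.
  have /allP/(_ (Z.to_nat r)) : all (fun i : nat => let r := Z.of_nat i in
    Z.eqb (15 * (r * r) + central_excess r) (76 * optimum r)) (iota 0 38) by vm_compute.
  by rewrite mem_iota Z2Nat.id; [move=> H; apply/Z.eqb_eq/H; lia | lia].
by rewrite gE FE nE; lia.
Qed.

Lemma nearest_optimal (n : Z) : (5 <= n ->
  schur_closed n (nearest_s n) (nearest_t n) = optimum n)%ZZ.
Proof.
move=> n5.
have [s1 s2] : (8 * n - 18 <= 38 * nearest_s n /\ 38 * nearest_s n <= 8 * n + 19)%ZZ.
  by rewrite /nearest_s; Z.to_euclidean_division_equations; lia.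
have [t1 t2] : (24 * n - 18 <= 38 * nearest_t n /\ 38 * nearest_t n <= 24 * n + 19)%ZZ.
  by rewrite /nearest_t; Z.to_euclidean_division_equations; lia.
have [] := @central_identity n (nearest_s n) (nearest_t n); try lia.
have := nearest_optimum n; rewrite /central_excess; lia.
Qed.

(** * Small n and the final assembly *)

Lemma small_lower (n s t : nat) :
  n < 42 -> 0 < s -> s <= t -> t <= n ->
  (optimum (Z.of_nat n) <= schur_closed (Z.of_nat n) (Z.of_nat s) (Z.of_nat t))%ZZ.
Proof.
move=> n42 s0 st tn.
have /allP/(_ n) H : all (fun n => all (fun t => all (fun s => Z.leb (optimum (Z.of_nat n))
  (schur_closed (Z.of_nat n) (Z.of_nat s) (Z.of_nat t))) (iota 1 t)) (iota 1 n)) (iota 0 42).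
  by vm_compute.
have /allP/(_ t) {}H := H ltac:(rewrite mem_iota; lia).
have /allP/(_ s) {}H := H ltac:(rewrite mem_iota; lia).
by apply/Z.leb_le/H; rewrite mem_iota; lia.
Qed.

Lemma Z_of_int_Mformula (n : nat) : Z_of_int (Mformula n) = optimum (Z.of_nat n).
Proof.
rewrite /Mformula /optimum -mulnn.
have -> : ((15 * (Z.of_nat n * Z.of_nat n) + 72) / 76)%ZZ =
    Z.of_nat ((15 * (n * n) + 72) %/ 76).
  by Z.to_euclidean_division_equations; lia.
have -> : (Z.of_nat n mod 38)%ZZ = Z.of_nat (n %% 38).
  by Z.to_euclidean_division_equations; lia.
move: (_ %% 38) (_ %/ 76) => r q.
have eqbE (m : nat) : Z.eqb (Z.of_nat r) (Z.of_nat m) = (r == m) by apply/idP/idP; lia.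
rewrite (eqbE 18) (eqbE 20) (eqbE 19).
by case: ifP => _; last case: ifP => _; lia.
Qed.

(* min_{1<=s<=t<=n} Mhalf n s t = Mformula n, stated as: the value is attained
   and is a lower bound. *)
Theorem theorem4p5 (n : nat) : 1 <= n ->
  (exists s t, [/\ 1 <= s, s <= t, t <= n & Posz (Mhalf n s t) = Mformula n]) /\
  (forall s t, 1 <= s -> s <= t -> t <= n -> (Mformula n <= Posz (Mhalf n s t))%R).
Proof.
move=> n1; have FE := Z_of_int_Mformula n; split=> [|s t s1 st tn].
  have attained s t : s <= t -> t <= n ->
      schur_closed (Z.of_nat n) (Z.of_nat s) (Z.of_nat t) = optimum (Z.of_nat n) ->
      Posz (Mhalf n s t) = Mformula n.
    move=> st tn ME; apply: (can_inj Z_of_intK).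
    by rewrite FE -ME -Mhalf_closed.
  have [n5|n5] := leqP 5 n.
    exists ((8 * n + 19) %/ 38), ((24 * n + 19) %/ 38); split; try lia.
    apply: attained; try lia.
    rewrite -nearest_optimal; last lia.
    by congr schur_closed; rewrite /nearest_s /nearest_t; Z.to_euclidean_division_equations; lia.
  (* Below 5 the rounded pair may have s = 0 (n = 1, 2) or violate 3t <= 2n (n = 4), so explicit
     witnesses are evaluated. *)
  case: n n1 n5 {FE} attained => [|[|[|[|[|n]]]]] // _ _ attained.
  - by exists 1, 1; split=> //; apply: attained.
  - by exists 1, 2; split=> //; apply: attained.
  - by exists 1, 2; split=> //; apply: attained.
  - by exists 1, 3; split=> //; apply: attained.
suff : (optimum (Z.of_nat n) <= Z.of_nat (Mhalf n s t))%ZZ by lia.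
rewrite Mhalf_closed //.
have [n42|n42] := ltnP n 42; first exact: small_lower.
have [h|h] : ((Z.of_nat n <= 2 * Z.of_nat t /\ 3 * Z.of_nat t <= 2 * Z.of_nat n /\
    2 * (Z.of_nat t - Z.of_nat s) <= Z.of_nat n /\ 2 * Z.of_nat s <= Z.of_nat n) \/
  (2 * Z.of_nat t <= Z.of_nat n \/ Z.of_nat n <= 2 * Z.of_nat s \/
   Z.of_nat n <= 2 * (Z.of_nat t - Z.of_nat s) \/ 2 * Z.of_nat n <= 3 * Z.of_nat t))%ZZ by lia.
  by apply: central_lower; lia.
by apply: outer_lower; lia.
Qed.
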